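(* Let $T$ be a tree on $n\geq 6$ vertices, and let $g_0\geq 2$ be the smallest positive integer such that $2^{g_0-1}+g_0\geq n-3$. Then $d_T(C,\mathfrak{C})\leq \left\lfloor \frac{n-g_0-4}{2} \right\rfloor$, and equality holds if $T$ is isomorphic to the path-star tree $P_{n-g_0,g_0}$.
   Context: For a tree $T$ and $u,v\in V(T)$, $d_T(u,v)$ is the number of edges of the $u$-$v$ path; for $X,Y\subseteq V(T)$, $d(X,Y)=\min\{d_T(x,y): x\in X, y\in Y\}$. The center $C(T)$ is the set of vertices $v$ minimizing the eccentricity $e(v)=\max\{d_T(v,u): u\in V(T)\}$. For $u,v\in V(T)$, $f_T(v,u)$ is the number of subtrees (connected subgraphs) of $T$ containing both $v$ and $u$. The eccentric subtree number of $v$ is $\epsilon_T(v)=\min\{f_T(v,u):u\in V(T)\}$, and the core center $\mathfrak{C}(T)$ is the set of vertices maximizing $\epsilon_T$. Write $d_T(C,\mathfrak{C})=d(C(T),\mathfrak{C}(T))$. For integers $1\leq g\leq n-2$, the path-star tree $P_{n-g,g}$ is the tree on $n$ vertices obtained from the path $12\cdots (n-g)$ by attaching $g$ pendant vertices to the vertex $n-g$. *)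

(* Defs.v *)
From mathcomp Require Import all_boot.

Set Implicit Arguments.
Unset Strict Implicit.
Unset Printing Implicit Defensive.

(* A finite simple graph on V is a symmetric irreflexive e : rel V. *)

Section Tree.

Variables (V : finType) (e : rel V).

(* A closed walk without repeated vertices is a graph cycle only from length 3
   on: a single edge traversed back and forth satisfies ucycle. *)
Definition is_tree : Prop :=
  [/\ symmetric e, irreflexive e,
      forall x y : V, connect e x y
    & forall c : seq V, 2 < size c -> ~~ ucycleb e c].

Definition has_simple_path (u v : V) (k : nat) : bool :=
  [exists p : k.-tuple V, [&& path e u p, last u p == v & uniq (u :: p)]].

(* The least length of a simple path from u to v (in a tree, the length of the
   only one), or #|V| if there is none; a simple path has fewer than #|V|
   edges. *)
Definition dist (u v : V) : nat := find (has_simple_path u v) (iota 0 #|V|).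

(* The default value #|V| of the minimum exceeds every distance in a connected
   graph, so it is returned only if X or Y is empty. *)
Definition set_dist (X Y : {set V}) : nat :=
  \big[minn/#|V|]_(x in X) \big[minn/#|V|]_(y in Y) dist x y.

Definition eccentricity (v : V) : nat := \max_(u : V) dist v u.

Definition center : {set V} :=
  [set v | [forall w, eccentricity v <= eccentricity w]].

Definition edges : {set {set V}} :=
  [set [set p.1; p.2] | p in [set p : V * V | e p.1 p.2]].

(* H.1 is the vertex set and H.2 the edge set of a subgraph H, which need not
   be an induced subgraph. *)
Definition is_subgraph (H : {set V} * {set {set V}}) : bool :=
  (H.2 \subset edges) && [forall A in H.2, A \subset H.1].

Definition is_subtree (H : {set V} * {set {set V}}) : bool :=
  [&& is_subgraph H, H.1 != set0
    & [forall x in H.1, forall y in H.1,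
        connect [rel a b | [set a; b] \in H.2] x y]].

Definition subtree_number (v u : V) : nat :=
  #|[set H | [&& is_subtree H, v \in H.1 & u \in H.1]]|.

(* The default value of the minimum is the term for u = v. *)
Definition ecc_subtree_number (v : V) : nat :=
  \big[minn/subtree_number v v]_(u : V) subtree_number v u.

Definition core_center : {set V} :=
  [set v | [forall w, ecc_subtree_number w <= ecc_subtree_number v]].

Definition center_core_dist : nat := set_dist center core_center.

End Tree.

(* The path-star tree P_{k,g}, numbered from 0: the path is 0, ..., k - 1 and the pendant
   vertices k, ..., k + g - 1 are attached to k - 1. *)
Definition path_star_arc (k g : nat) (i j : 'I_(k + g)) : bool :=
  ((i.+1 == j :> nat) && (j < k)) || ((i.+1 == k :> nat) && (k <= j)).

Definition path_star (k g : nat) : rel 'I_(k + g) :=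
  [rel i j | path_star_arc i j || path_star_arc j i].

Arguments path_star : clear implicits.

Definition graph_iso (V W : finType) (e : rel V) (e' : rel W) : Prop :=
  exists2 f : V -> W, bijective f & forall x y : V, e' (f x) (f y) = e x y.

(* Main.v *)
Require Import Defs.
From mathcomp Require Import all_boot.
From mathcomp Require Import zify.

Set Implicit Arguments.
Unset Strict Implicit.
Unset Printing Implicit Defensive.

(** Write f(v,u) for the number of subtrees containing v and u.  A subtree is
    determined by its vertex set, so f counts connected vertex sets, which in a
    tree are exactly the path-convex ones (subtree_numberE,
    connected_set_convex).

    Upper bound.  Take c in the center and w in the core center at minimal
    distance d > 0, and let v be the neighbour of w towards c.  Since v is not
    in the core center, its eccentric subtree number f(v,u) is smaller than
    every f(w,t), which forces u to lie on the side of w away from v.  Since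
    the neighbour of c towards w is not in the center, some leaf z on the other
    side of c is at distance r = e(c) from c.  So there is one path
    z .. c .. v w .. u.  Let s + 1 = d(v,z), q = d(w,u), and let G be the number
    of subtrees containing the whole path.
    - A subtree through v and u either contains z, which makes G of them, or
      stops short of z at one of s + 1 places.  Removing the leaf z shows that
      at least G subtrees stop right before z, and at least one stops at each
      of the other s places, so f(v,u) >= s + 2G (path_leq_card_supersets).
    - A subtree through w and z reaches u or leaves the path at one of q places
      before it, and completing it up to u is injective for each of them:
      f(w,z) <= (q + 1) G (card_supersets_leq_path).
    - G <= 2^x, where x is the number of vertices outside the path.
    From f(v,u) < f(w,z) one gets s < (q - 1) 2^x, with x = n - (s + q + 3)
    and d + q <= r = s + 2 - d.  The minimality of g0, applied to g0 - 1, makes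
    this incompatible with a value of d above the bound (gap_bound).

    Equality.  In the path-star tree number the path 0 .. k - 1 and give all
    pendant vertices position k; adjacency means that positions differ by one.
    The center is at position k / 2 or beyond (center_pos).  A vertex w
    at position at least 3 is not in the core center, because its predecessor v
    does better (core_center_pos): for u behind v, f(v,u) > f(w,u); for u
    beyond v, deleting none, one or two vertices at the free end of the path
    shows f(v,u) >= 3 * 2^(g-1), while the subtrees through w and the free end
    number at most 2^g + (k - 4) < 3 * 2^(g-1). *)

(** * Paths and distances in a tree *)

Section Reversal.

Variables (V : finType) (e : rel V).
Hypothesis e_sym : symmetric e.

Lemma rev_path_uniq (x : V) (p : seq V) :
  path e x p -> uniq (x :: p) ->
  [/\ path e (last x p) (rev (belast x p)), uniq (last x p :: rev (belast x p)),
      last (last x p) (rev (belast x p)) = x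
    & last x p :: rev (belast x p) = rev (x :: p)].
Proof.
move=> ep up.
have E : last x p :: rev (belast x p) = rev (x :: p) by rewrite [in RHS]lastI rev_rcons.
split=> //.
- rewrite rev_path; apply: sub_path ep => a b; by rewrite /= e_sym.
- by rewrite E rev_uniq.
- case: p {ep up E} => [|a p] //=; by rewrite rev_cons last_rcons.
Qed.

Lemma connect_uniq_path (x y : V) :
  connect e x y -> exists2 p, path e x p & uniq (x :: p) /\ last x p = y.
Proof.
case/connectP=> p ep ->; case/shortenP: ep => q eq uq _.
by exists q.
Qed.

End Reversal.

Section Trees.

Variables (V : finType) (e : rel V).
Hypothesis hT : is_tree e.

Lemma tree_sym : symmetric e. Proof. by case: hT. Qed.

Lemma tree_connect (x y : V) : connect e x y. Proof. by case: hT. Qed.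

Lemma tree_path (x y : V) :
  exists2 p, path e x p & uniq (x :: p) /\ last x p = y.
Proof. exact: connect_uniq_path (tree_connect x y). Qed.

(** Every edge is a bridge: a simple path from a back to x that does not use the
    edge xa would close up with it to a cycle. *)
Lemma tree_bridge (x a : V) : e x a ->
  ~~ connect [rel u v | e u v && ([set u; v] != [set x; a])] a x.
Proof.
move=> exa; apply/negP=> /connect_uniq_path [p ep [up lp]].
case: hT => _ irr _ acyc.
have ep' : path e a p by apply: sub_path ep => u v /= /andP[].
have szp : 2 < size (a :: p).
  case: p ep up lp {ep'} => [|b [|c p]] //=.
    by move=> _ _ ax; rewrite ax irr in exa.
  by move=> + _ bx; rewrite bx setUC eqxx andbF.
apply/negP: (acyc (a :: p) szp); rewrite negbK /ucycleb up andbT /cycle.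
by rewrite rcons_path ep' lp.
Qed.

(** At the first vertex where two simple paths with the same ends diverge, the
    two tails would join the ends of an edge without using it, against
    tree_bridge. *)
Lemma tree_path_unique (x : V) (p q : seq V) :
  path e x p -> uniq (x :: p) -> path e x q -> uniq (x :: q) ->
  last x p = last x q -> p = q.
Proof.
elim: p x q => [|a p IH] x [|b q] //.
- by move=> _ _ _ /= /andP[/negP nx _] xE; case: nx; rewrite xE mem_last.
- by move=> _ /= /andP[/negP nx _] _ _ xE; case: nx; rewrite -xE mem_last.
move=> ep up eq uq El.
case: (altP (a =P b)) => [ab|nab].
  rewrite -ab in eq uq El *; congr cons; apply: (IH a) => //.
  - by case/andP: ep.
  - by case/andP: up.
  - by case/andP: eq.
  - by case/andP: uq.
have exa : e x a by case/andP: ep.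
case/negP: (tree_bridge exa).
(* Both tails avoid x, hence the edge xa, and so they link a to b, a neighbour of x. *)
pose e' := [rel u v | e u v && ([set u; v] != [set x; a])].
have avoid s y : path e y s -> x \notin y :: s -> path e' y s.
  elim: s y => //= c s IHs y /andP[eyc es].
  rewrite in_cons negb_or => /andP[xy xs].
  rewrite eyc IHs ?andbT //=.
  apply: contraNneq xs => E.
  have : x \in [set y; c] by rewrite E set21.
  by rewrite !inE (negbTE xy) /= => ->.
have e'sym : connect_sym e'.
  by apply: sym_connect_sym => u v; rewrite /= tree_sym setUC.
apply: (@connect_trans _ _ (last a p)).
  apply/connectP; exists p => //; apply: avoid; first by case/andP: ep.
  by case/andP: up.
rewrite -/e' e'sym; move: El => /= ->.
apply: (@connect_trans _ _ b).
  apply: connect1 => /=; case/andP: (eq) => -> _ /=.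
  apply: contraNneq nab => E.
  have : a \in [set x; b] by rewrite E set22.
  rewrite !inE => /orP[/eqP ax|//].
  by move: up; rewrite ax /= inE eqxx.
apply/connectP; exists q => //; apply: avoid; first by case/andP: eq.
by case/andP: uq.
Qed.

(** By uniqueness, any simple path computes the distance; together with
    tree_path this is how distances are evaluated below. *)
Lemma dist_path (x : V) (p : seq V) :
  path e x p -> uniq (x :: p) -> dist e x (last x p) = size p.
Proof.
move=> ep up; rewrite /dist.
have hE k : has_simple_path e x (last x p) k = (k == size p).
  apply/existsP/eqP => [[q /and3P[eq /eqP lq uq]]|->].
    by rewrite (tree_path_unique ep up eq uq) ?size_tuple.
  by exists (in_tuple p); rewrite ep eqxx up.
have lt : size p < #|V|.
  by rewrite -[_ < _]/(size (x :: p) <= _) -(card_uniqP up) max_card.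
rewrite (eq_find hE) -[find _ _]/(index (size p) (iota 0 #|V|)).
by rewrite -{1}[size p](nth_iota 0 0 lt) index_uniq ?size_iota ?iota_uniq.
Qed.

Lemma dist_walk (x : V) (p : seq V) : path e x p -> dist e x (last x p) <= size p.
Proof.
case/shortenP=> q eq uq sub.
rewrite dist_path //; apply: uniq_leq_size => //.
by case/andP: uq.
Qed.

Lemma dist_sym (x y : V) : dist e x y = dist e y x.
Proof.
have [p ep [up <-]] := tree_path x y.
rewrite dist_path //.
have [er ur lr _] := rev_path_uniq tree_sym ep up.
by rewrite -[X in dist _ _ X]lr dist_path // size_rev size_belast.
Qed.

Lemma dist_step (x y z : V) : e x y -> dist e x z <= (dist e y z).+1.
Proof.
move=> exy; have [p ep [up <-]] := tree_path y z.
rewrite (dist_path ep up).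
by apply: (@dist_walk x (y :: p)); rewrite /= exy.
Qed.

(** A common vertex would be reached from x by two simple paths with different
    first steps. *)
Lemma branches_disjoint (x a b : V) (p q : seq V) :
  path e x (a :: p) -> uniq (x :: a :: p) ->
  path e x (b :: q) -> uniq (x :: b :: q) -> a != b ->
  ~~ has (mem (a :: p)) (b :: q).
Proof.
move=> ep up eq uq nab; apply/negP=> /hasP[t tq tp].
have pre c s : path e x (c :: s) -> uniq (x :: c :: s) -> t \in c :: s ->
  exists2 s', path e x (c :: s') & uniq (x :: c :: s') /\ last x (c :: s') = t.
  move=> es us ts; case: (splitPl ts) es us => s1 s2 l1.
  rewrite -cat_cons cat_path -cat_cons cat_uniq => /andP[es1 _] /andP[us1 _].
  by exists s1.
have [p' ep' [up' lp]] := pre _ _ ep up tp.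
have [q' eq' [uq' lq]] := pre _ _ eq uq tq.
have := tree_path_unique ep' up' eq' uq'.
by rewrite lp lq => /(_ erefl)[/eqP]; rewrite (negbTE nab).
Qed.

(** Concatenating two simple paths at y gives a simple path as soon as it does
    not turn back at y. *)
Lemma path_join (x y : V) (p q : seq V) :
  path e x (rcons p y) -> uniq (x :: rcons p y) ->
  path e y q -> uniq (y :: q) ->
  ohead q != Some (last x p) ->
  path e x (rcons p y ++ q) /\ uniq (x :: rcons p y ++ q).
Proof.
move=> ep up eq uq hq; split.
  by rewrite cat_path ep last_rcons.
rewrite -cat_cons cat_uniq up; move: (uq); rewrite cons_uniq => /andP[yq ->].
rewrite andbT.
case: q eq uq hq yq => [|a q] // eq uq hq yq.
have [er ur _ Er] := rev_path_uniq tree_sym ep up.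
move: er ur Er; rewrite last_rcons belast_rcons.
rewrite [x :: p]lastI rev_rcons => er ur Er.
have := branches_disjoint er ur eq uq _; rewrite eq_sym => /(_ hq).
apply: contra => /hasP[t tq tp]; apply/hasP; exists t => //=.
have : t \in rev (x :: rcons p y) by rewrite mem_rev.
rewrite -Er in_cons => /orP[/eqP ty|//].
by rewrite ty (negbTE (_ : y \notin _)) in tq.
Qed.

End Trees.

(** * Connected vertex sets *)

Lemma leq_card_inj (A B : finType) (X : {set A}) (Y : {set B}) (f : A -> B) :
  {in X &, injective f} -> {in X, forall x, f x \in Y} -> #|X| <= #|Y|.
Proof.
move=> injf fXY; rewrite -(card_in_imset injf); apply: subset_leq_card.
by apply/subsetP=> _ /imsetP[x xX ->]; apply: fXY.
Qed.

Lemma card_supersets (A : finType) (P : {set A}) :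
  #|[set S : {set A} | P \subset S]| = 2 ^ (#|A| - #|P|).
Proof.
rewrite -(cardsC P) addKn -card_powerset.
 apply/eqP; rewrite eqn_leq; apply/andP; split.
  apply: (@leq_card_inj _ _ _ _ (fun S => S :\: P)) => [S S'|S].
    rewrite !inE => sS sS' E.
    by rewrite -(setID S P) -(setID S' P) E (setIidPr sS) (setIidPr sS').
  by rewrite !inE setDE subsetIr.
apply: (@leq_card_inj _ _ _ _ (fun S => P :|: S)) => [S S'|S].
  rewrite !inE => sS sS' E.
  have D (T : {set A}) : T \subset ~: P -> T = (P :|: T) :\: P.
    by move=> sT; rewrite setDUl setDv set0U setDE (setIidPl sT).
  by rewrite (D S) // (D S') // E.
by rewrite !inE subsetUl.
Qed.

Section ConnectedSets.

Variables (V : finType) (e : rel V).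

Definition inner_rel (S : {set V}) : rel V :=
  [rel a b | [&& a \in S, b \in S & e a b]].

Definition connected_set (S : {set V}) : bool :=
  [forall x in S, forall y in S, connect (inner_rel S) x y].

Definition connected_supersets (Z : {set V}) : {set {set V}} :=
  [set S | connected_set S & Z \subset S].

Definition connected_avoiding (Z : {set V}) (y : V) : {set {set V}} :=
  [set S in connected_supersets Z | y \notin S].

Lemma connected_setP (S : {set V}) :
  reflect {in S &, forall x y, connect (inner_rel S) x y} (connected_set S).
Proof.
apply: (iffP forall_inP) => [h x y xS yS|h x xS].
  exact: (forall_inP (h x xS)).
by apply/forall_inP=> y yS; apply: h.
Qed.

Lemma inner_path_sub (S : {set V}) (x : V) (p : seq V) :
  path (inner_rel S) x p -> path e x p /\ {subset p <= S}.
Proof.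
elim: p x => [|a p IH] x //= /andP[/and3P[xS aS exa] /IH[-> sub]].
by rewrite exa; split=> // t; rewrite inE => /orP[/eqP->|/sub].
Qed.

Lemma path_inner (S : {set V}) (x : V) (p : seq V) :
  path e x p -> x \in S -> {subset p <= S} -> path (inner_rel S) x p.
Proof.
elim: p x => [|a p IH] x //= /andP[exa ep] xS sub.
rewrite /inner_rel /= xS exa sub ?mem_head //= IH ?sub ?mem_head // => t tp.
by rewrite sub // inE tp orbT.
Qed.

Hypothesis e_sym : symmetric e.

Lemma connected_set_root (S : {set V}) (x : V) :
  {in S, forall y, connect (inner_rel S) x y} -> connected_set S.
Proof.
move=> h; apply/connected_setP=> a b aS bS.
have sc : connect_sym (inner_rel S).
  by apply: sym_connect_sym => u v; rewrite /inner_rel /= e_sym andbCA.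
by apply: (@connect_trans _ _ x); rewrite ?h // sc h.
Qed.

Lemma connected_set1 (x : V) : connected_set [set x].
Proof. by apply: (@connected_set_root _ x) => y /set1P->. Qed.

Lemma inner_connect_sub (S S' : {set V}) (x y : V) :
  S \subset S' -> connect (inner_rel S) x y -> connect (inner_rel S') x y.
Proof.
move=> /subsetP sub; apply: connect_sub => a b /and3P[aS bS eab].
by apply: connect1; rewrite /inner_rel /= !sub.
Qed.

Lemma connected_setU1 (S : {set V}) (y z : V) :
  connected_set S -> y \in S -> e y z -> connected_set (z |: S).
Proof.
move=> /connected_setP cS yS eyz; apply: (@connected_set_root _ y) => t.
case/setU1P=> [->|tS]; first by apply: connect1; rewrite /inner_rel /= setU11 setU1r.
by apply: inner_connect_sub (cS _ _ yS tS); apply: subsetUr.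
Qed.

Lemma connected_set_path (S : {set V}) (y : V) (p : seq V) :
  connected_set S -> y \in S -> path e y p ->
  connected_set (S :|: [set x in p]).
Proof.
elim: p y S => [|a p IH] y S cS yS /=.
  have -> : [set x in [::]] = set0 :> {set V} by apply/setP => t; rewrite !inE.
  by rewrite setU0.
case/andP=> eya ep; rewrite set_cons setUA [S :|: _]setUC.
by apply: (IH a) => //; [apply: connected_setU1 eya | rewrite setU11].
Qed.

(** Removing a vertex with at most one neighbour inside S: such a vertex cannot
    be interior to a simple path in S. *)
Lemma connected_setD1 (S : {set V}) (z : V) :
  connected_set S -> {in S &, forall a b, e z a -> e z b -> a = b} ->
  connected_set (S :\ z).
Proof.
move=> /connected_setP cS leaf; apply/connected_setP=> x y.
rewrite !inE => /andP[xz xS] /andP[yz yS].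
have [p ep [up lp]] := connect_uniq_path (cS _ _ xS yS).
have [ep' pS] := inner_path_sub ep.
have zp : z \notin p.
  apply/negP=> zp; case: (splitPr zp) lp up ep' pS => p1 [|b p2].
    by rewrite last_cat /= => E; rewrite E eqxx in yz.
  rewrite -cat_cons cat_uniq cat_path /= => _ /and4P[up1 h _ _].
  case/and4P=> ep1 ez ezb _ pS.
  have E : last x p1 = b.
    apply: leaf => //; last by rewrite e_sym.
      case: (lastP p1) pS {h up1 ep1 ez} => // s t pS.
      by rewrite last_rcons pS // mem_cat mem_rcons mem_head.
    by rewrite pS // mem_cat !inE eqxx !orbT.
  move: h; rewrite -E. by rewrite mem_last orbT.
apply/connectP; exists p => //; apply: path_inner => //.
  by rewrite !inE xz xS.
move=> t tp; rewrite !inE pS // andbT.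
by apply: contraNneq zp => <-.
Qed.

Lemma leq_connected_supersets (Z Z' : {set V}) :
  (forall S, connected_set S -> Z \subset S -> Z' \subset S) ->
  #|connected_supersets Z| <= #|connected_supersets Z'|.
Proof.
move=> h; apply: subset_leq_card; apply/subsetP=> S; rewrite !inE.
by case/andP=> cS /(h _ cS) ->; rewrite cS.
Qed.

Lemma connected_supersets_split (Z : {set V}) (y : V) :
  #|connected_supersets Z| =
  #|connected_avoiding Z y| + #|connected_supersets (y |: Z)|.
Proof.
rewrite -(cardsID [set S : {set V} | y \in S]) addnC; congr (_ + _).
  by apply: eq_card => S; rewrite !inE andbC.
by apply: eq_card => S; rewrite !inE subUset sub1set -!andbA; do !bool_congr.
Qed.

End ConnectedSets.

(** * Counting subtrees along a path *)

Section Subtrees.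

Variables (V : finType) (e : rel V).
Hypothesis hT : is_tree e.

Let e_sym := tree_sym hT.

(** The simple path inside S given by connectedness is the only simple path of
    the tree between its ends. *)
Lemma connected_set_convex (S : {set V}) (x : V) (p : seq V) :
  connected_set e S -> x \in S -> path e x p -> uniq (x :: p) ->
  last x p \in S -> {subset x :: p <= S}.
Proof.
move=> /connected_setP cS xS ep up lS.
have [q eq [uq lq]] := connect_uniq_path (cS _ _ xS lS).
have [eq' qS] := inner_path_sub eq.
rewrite (tree_path_unique hT ep up eq' uq) // => t.
by rewrite inE => /orP[/eqP->|/qS].
Qed.

Lemma edges_pair (a b : V) : ([set a; b] \in edges e) = e a b.
Proof.
apply/imsetP/idP => [[[x y]]|eab]; last by exists (a, b); rewrite ?inE.
rewrite inE /= => exy E.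
have [xE yE] : x \in [set a; b] /\ y \in [set a; b] by rewrite E !inE !eqxx orbT.
have [_ irr _ _] := hT.
move: xE yE exy; rewrite !inE => /orP[]/eqP-> /orP[]/eqP->; rewrite ?irr //.
by rewrite e_sym.
Qed.

Definition inner_edges (S : {set V}) : {set {set V}} :=
  [set A in edges e | A \subset S].

Lemma inner_edges_pair (S : {set V}) (a b : V) :
  ([set a; b] \in inner_edges S) = inner_rel e S a b.
Proof. by rewrite inE edges_pair subUset !sub1set andbC -andbA. Qed.

(** A subtree is an induced subgraph: an edge xy of the tree between two of its
    vertices is the only connection from y to x, so it cannot be missing. *)
Lemma subtree_connected (H : {set V} * {set {set V}}) :
  is_subtree e H -> connected_set e H.1 /\ H.2 = inner_edges H.1.
Proof.
case: H => S E; rewrite /is_subtree /is_subgraph /=.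
case/and3P=> /andP[/subsetP sE /forall_inP ES] _ cS.
have EP a b : [set a; b] \in E -> inner_rel e S a b.
  by move=> abE; rewrite -inner_edges_pair inE sE ?ES.
have cSP x y : x \in S -> y \in S -> connect [rel a b | [set a; b] \in E] x y.
  by move=> xS yS; apply: (forall_inP (forall_inP cS x xS)).
split.
  apply/connected_setP=> x y xS yS.
  apply: connect_sub (cSP x y xS yS) => a b abE.
  by apply/connect1/EP.
apply/setP=> A; apply/idP/idP=> [AE|]; first by rewrite inE sE ?ES.
rewrite inE => /andP[/imsetP[[x y]]]; rewrite inE /= => exy -> {A}.
rewrite subUset !sub1set => /andP[xS yS].
apply: contraT => nE; case/negP: (tree_bridge hT exy).
apply: connect_sub (cSP y x yS xS) => a b abE; apply: connect1 => /=.
have /and3P[_ _ ->] := EP a b abE.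
by apply: contraNneq nE => <-.
Qed.

Lemma connected_subtree (S : {set V}) :
  connected_set e S -> S != set0 -> is_subtree e (S, inner_edges S).
Proof.
move=> /connected_setP cS S0; rewrite /is_subtree /is_subgraph /= S0 /=.
apply/andP; split.
  apply/andP; split; first by apply/subsetP=> A; rewrite inE => /andP[].
  by apply/forall_inP=> A; rewrite inE => /andP[].
apply/forall_inP=> x xS; apply/forall_inP=> y yS.
apply: connect_sub (cS x y xS yS) => a b ab; apply: connect1.
by rewrite /= inner_edges_pair.
Qed.

Lemma subtree_numberE (v u : V) :
  subtree_number e v u = #|connected_supersets e [set v; u]|.
Proof.
apply/eqP; rewrite eqn_leq; apply/andP; split.
  apply: (@leq_card_inj _ _ _ _ fst) => [H H'|H]; rewrite !inE.
    case/andP=> /subtree_connected[_ E] _ /andP[/subtree_connected[_ E'] _].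
    by case: H H' E E' => [S E] [S' E'] /= -> -> ->.
  case/and3P=> /subtree_connected[-> _] vS uS.
  by rewrite subUset !sub1set vS.
apply: (@leq_card_inj _ _ _ _ (fun S => (S, inner_edges S))) => [S S' _ _ []//|S].
rewrite !inE subUset !sub1set => /and3P[cS vS uS].
by rewrite vS uS connected_subtree //; apply/set0Pn; exists v.
Qed.

(** A subtree through w that misses the next vertex y meets nothing of the path
    beyond w; gluing that path to it is therefore injective. *)
Lemma card_avoiding_leq (Z : {set V}) (w y : V) (q : seq V) :
  w \in Z -> path e w (y :: q) -> uniq (w :: y :: q) ->
  #|connected_avoiding e Z y| <= #|connected_supersets e (last y q |: Z)|.
Proof.
move=> wZ ep up; pose Q := [set x in y :: q].
have disj S : S \in connected_avoiding e Z y -> S = (S :|: Q) :\: Q.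
  rewrite !inE -andbA => /and3P[cS /subsetP ZS yS].
  rewrite setDUl setDv setU0 setDE; symmetry; apply/setIidPl/subsetP => t tS.
  rewrite !inE -in_cons; apply/negP => tq.
  case: (splitPl tq) ep up => q1 q2 lt.
  rewrite -cat_cons cat_path -cat_cons cat_uniq => /andP[ep _] /andP[up _].
  have := connected_set_convex cS (ZS _ wZ) ep up.
  rewrite /= lt => /(_ tS) /(_ y); rewrite !inE eqxx orbT => /(_ isT).
  exact/negP.
apply: (@leq_card_inj _ _ _ _ (fun S => S :|: Q)) => [S S' hS hS' E|S].
  by rewrite (disj S) // (disj S') // E.
rewrite !inE -andbA => /and3P[cS ZS yS].
rewrite (connected_set_path e_sym cS (subsetP ZS _ wZ) ep) /=.
rewrite subUset sub1set (subset_trans ZS) ?subsetUl // andbT.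
by rewrite !inE -in_cons mem_last orbT.
Qed.

(** Sort the subtrees by the place where they leave the path from w: there are
    size q + 1 places, the end included, each accounting for at most as many
    subtrees as reach the end. *)
Lemma card_supersets_leq_path (Z : {set V}) (w : V) (q : seq V) :
  w \in Z -> path e w q -> uniq (w :: q) ->
  #|connected_supersets e Z|
    <= (size q).+1 * #|connected_supersets e (last w q |: Z)|.
Proof.
elim: q w Z => [|y q IH] w Z wZ ep up /=.
  by rewrite mul1n (setUidPr _) // sub1set.
rewrite (connected_supersets_split e Z y) mulSn leq_add //.
  exact: card_avoiding_leq ep up.
have ep' : path e y q by case/andP: ep.
have up' : uniq (y :: q) by case/andP: up.
apply: leq_trans (IH y _ (setU11 _ _) ep' up') _.
rewrite leq_mul2l; apply/orP; right; apply: leq_connected_supersets => S _.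
by apply: subset_trans; rewrite setUCA subsetUr.
Qed.

(** The converse estimate: among the subtrees that do not reach the end of the
    path, those stopping right before it are at least as many as those reaching
    it, since the end is a leaf and can be removed, and there is at least one
    for each earlier place.  The set S0 witnesses the latter; in the induction it
    grows along the path. *)
Lemma path_leq_card_supersets (Z S0 : {set V}) (v y : V) (q : seq V) :
  v \in Z -> connected_set e S0 -> Z \subset S0 ->
  path e v (y :: q) -> uniq (v :: y :: q) ->
  {in y :: q, forall t, t \notin S0} ->
  (forall a b, e (last y q) a -> e (last y q) b -> a = b) ->
  size q + #|connected_supersets e (last y q |: Z)|.*2
    <= #|connected_supersets e Z|.
Proof.
elim: q v y Z S0 => [|y' q IH] v y Z S0 vZ cS0 ZS0 ep up dS0 leaf.
  rewrite /= add0n -addnn (connected_supersets_split e Z y) leq_add2r.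
  have yZ : y \notin Z by apply: contra (dS0 _ (mem_head _ _)); apply: (subsetP ZS0).
  apply: (@leq_card_inj _ _ _ _ (fun S => S :\ y)) => [S S'|S]; rewrite !inE.
    rewrite !subUset !sub1set => /and3P[_ yS _] /and3P[_ yS' _] E.
    by rewrite -(setD1K yS) -(setD1K yS') E.
  rewrite subUset sub1set eqxx /= andbT => /and3P[cS yS ZS].
  rewrite connected_setD1 //=; last by move=> a b _ _; apply: leaf.
  by rewrite subsetD1 ZS yZ.
rewrite (connected_supersets_split e Z y) addSn -add1n; apply: leq_add.
  rewrite card_gt0; apply/set0Pn; exists S0.
  by rewrite !inE cS0 ZS0 dS0 ?mem_head.
have [evy ep'] : e v y /\ path e y (y' :: q) by apply/andP.
have up' : uniq (y :: y' :: q) by case/andP: up.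
apply: leq_trans (IH y y' (y |: Z) (y |: S0) _ _ _ ep' up' _ leaf).
- rewrite /= leq_add2l leq_double; apply: leq_connected_supersets => S cS.
  rewrite !subUset !sub1set => /andP[lS ZS]; rewrite lS ZS andbT /=.
  apply: (connected_set_convex cS (subsetP ZS _ vZ) ep up) => //.
  by rewrite !inE eqxx orbT.
- exact: setU11.
- by apply: connected_setU1 evy; rewrite ?(subsetP ZS0).
- exact: setUS.
- move=> t tq; rewrite !inE negb_or dS0 ?inE ?[_ \in q]tq ?andbT //; last first.
    by rewrite -in_cons tq orbT.
  by case/andP: up' => yq _; apply: contraNneq yq => <-.
Qed.

End Subtrees.

(** * The inequality between the two sides of an edge *)

Lemma gap_arith (h q G X a b : nat) :
  h + G.*2 <= a -> b <= q.+1 * G -> G <= X -> a < b -> h < q.-1 * X.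
Proof.
move=> lower upper GX ab; have hG : h < q.-1 * G.
  by case: q upper => [|q] /= upper; nia.
by apply: leq_trans hG _; rewrite leq_mul2l GX orbT.
Qed.

Section Gap.

Variables (V : finType) (e : rel V).
Hypothesis hT : is_tree e.

Let e_sym := tree_sym hT.

(** Both bounds are expressed by the number of subtrees containing the path
    z .. v w .. u, and such a subtree is determined by the vertices it has
    outside the path. *)
Lemma subtree_number_gap (w v y : V) (Q U : seq V) :
  path e w (v :: y :: Q) -> uniq (w :: v :: y :: Q) ->
  path e w U -> uniq (w :: U) ->
  ohead U != Some v ->
  (forall a b, e (last y Q) a -> e (last y Q) b -> a = b) ->
  subtree_number e v (last w U) < subtree_number e w (last y Q) ->
  size U + size Q + 3 <= #|V| /\
  size Q < (size U).-1 * 2 ^ (#|V| - (size U + size Q + 3)).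
Proof.
move=> ep up eU uU hU leaf; set u := last w U; set z := last y Q.
have disj : ~~ has (mem (v :: y :: Q)) U.
  case: U eU uU hU {u} => // a U eU uU av.
  by apply: (branches_disjoint hT ep up eU uU); rewrite eq_sym.
have evw : e v w by rewrite e_sym; case/andP: ep.
have epv : path e v (y :: Q) by case/andP: ep.
have upv : uniq (v :: y :: Q) by case/andP: up.
have wQ : w \notin v :: y :: Q by case/andP: up.
have all_uniq : uniq ((v :: y :: Q) ++ w :: U).
  by rewrite cat_uniq upv uU /= andbT negb_or wQ disj.
pose P := [set x in (v :: y :: Q) ++ w :: U].
have cardP : size U + size Q + 3 = #|P|.
  by rewrite cardsE (card_uniqP all_uniq) size_cat /= !addnS !addSn addn0 addnC.
have evU : path e v (w :: U) by rewrite /= evw.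
have vwU : v \notin w :: U.
  by apply/negP=> vU; move: all_uniq; rewrite cat_cons cons_uniq mem_cat vU orbT.
have uvU : uniq (v :: w :: U) by rewrite cons_uniq vwU.
rewrite !subtree_numberE //.
have lower : size Q + #|connected_supersets e (z |: [set v; u])|.*2
    <= #|connected_supersets e [set v; u]|.
  pose S0 := [set v] :|: [set x in w :: U].
  apply: (@path_leq_card_supersets _ _ hT [set v; u] S0 v) => //.
  - exact: set21.
  - by apply: connected_set_path evU; rewrite ?set11 //; apply: connected_set1.
  - rewrite subUset !sub1set !inE eqxx /= -in_cons.
    by rewrite /u mem_last orbT.
  - move=> t tQ; rewrite !inE -in_cons negb_or; apply/andP; split.
      by case/andP: upv => vQ _; apply: contraNneq vQ => <-.
    apply/negP=> tU; move: all_uniq; rewrite cat_uniq => /and3P[_ /hasP h _].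
    by apply: h; exists t => //=; rewrite inE tQ orbT.
have upper : #|connected_supersets e [set w; z]|
    <= (size U).+1 * #|connected_supersets e (z |: [set v; u])|.
  apply: leq_trans (card_supersets_leq_path hT (set21 w z) eU uU) _.
  rewrite leq_mul2l /=; apply: leq_connected_supersets => S cS.
  rewrite !subUset !sub1set => /and3P[uS wS zS]; rewrite uS zS andbT.
  by apply: (connected_set_convex hT cS wS ep up) => //; rewrite !inE eqxx orbT.
have few : #|connected_supersets e (z |: [set v; u])|
    <= 2 ^ (#|V| - (size U + size Q + 3)).
  rewrite cardP -card_supersets; apply: subset_leq_card; apply/subsetP=> S.
  rewrite !inE !subUset !sub1set => /and4P[cS zS vS uS].
  apply/subsetP=> t; rewrite inE mem_cat => /orP[] tP.
    exact: (connected_set_convex hT cS vS epv upv).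
  apply: (connected_set_convex hT cS vS evU uvU) => //.
  by rewrite inE tP orbT.
move=> lt; split; first by rewrite cardP max_card.
exact: gap_arith lower upper few lt.
Qed.

End Gap.

(** * Centers and core centers *)

Section MinimumOverFintype.

Variables (I : finType) (P : pred I) (F : I -> nat) (m : nat).

Lemma bigminn_leq (i : I) : P i -> \big[minn/m]_(j | P j) F j <= F i.
Proof.
move=> Pi; have := mem_index_enum i; elim: (index_enum I) => //= a r IH.
rewrite inE big_cons => /orP[/eqP<-|/IH le]; first by rewrite Pi geq_minl.
by case: (P a) => //; apply: leq_trans (geq_minr _ _) le.
Qed.

Lemma leq_bigminn (k : nat) :
  k <= m -> (forall i, P i -> k <= F i) -> k <= \big[minn/m]_(j | P j) F j.
Proof.
move=> km kF; elim/big_ind: _ => // x y kx ky.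
by rewrite leq_min kx ky.
Qed.

Lemma bigminn_attained :
  \big[minn/m]_(j | P j) F j = m \/
  exists2 i, P i & \big[minn/m]_(j | P j) F j = F i.
Proof.
elim/big_ind: _ => [|x y hx hy|i Pi]; [by left| |by right; exists i].
by rewrite /minn; case: ifP.
Qed.

End MinimumOverFintype.

Section Centers.

Variables (V : finType) (e : rel V).

Lemma set_dist_leq (X Y : {set V}) (x y : V) :
  x \in X -> y \in Y -> set_dist e X Y <= dist e x y.
Proof.
move=> xX yY; apply: leq_trans (bigminn_leq _ _ xX) _.
exact: bigminn_leq.
Qed.

Lemma leq_set_dist (X Y : {set V}) (k : nat) :
  k <= #|V| -> {in X & Y, forall x y, k <= dist e x y} -> k <= set_dist e X Y.
Proof.
move=> kV h; apply: leq_bigminn => // x xX; apply: leq_bigminn => // y yY.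
exact: h.
Qed.

Lemma dist_leq_ecc (v u : V) : dist e v u <= eccentricity e v.
Proof. exact: leq_bigmax. Qed.

Lemma ecc_attained (v : V) : exists u, eccentricity e v = dist e v u.
Proof.
have V0 : 0 < #|V| by apply/card_gt0P; exists v.
by have [u] := eq_bigmax (dist e v) V0; exists u.
Qed.

Lemma ecc_subtree_leq (v u : V) :
  ecc_subtree_number e v <= subtree_number e v u.
Proof. exact: bigminn_leq. Qed.

Lemma ecc_subtree_attained (v : V) :
  exists u, ecc_subtree_number e v = subtree_number e v u.
Proof.
have [E|[u _ E]] := bigminn_attained predT (subtree_number e v) (subtree_number e v v).
  by exists v.
by exists u.
Qed.

Lemma center_lt (c x : V) :
  c \in center e -> x \notin center e -> eccentricity e c < eccentricity e x.
Proof.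
rewrite !inE => /forallP hc /forallPn[t]; rewrite -ltnNge.
exact: leq_ltn_trans (hc t).
Qed.

Lemma core_center_lt (w v : V) :
  w \in core_center e -> v \notin core_center e ->
  ecc_subtree_number e v < ecc_subtree_number e w.
Proof.
rewrite !inE => /forallP hw /forallPn[t]; rewrite -ltnNge => lt.
exact: leq_trans lt (hw t).
Qed.

Lemma center_nonempty : V -> exists c, c \in center e.
Proof.
move=> x0; case: (arg_minnP (eccentricity e) (erefl : predT x0)) => c _ h.
by exists c; rewrite inE; apply/forallP=> w; apply: h.
Qed.

Lemma core_center_nonempty : V -> exists w, w \in core_center e.
Proof.
move=> x0; case: (arg_maxnP (ecc_subtree_number e) (erefl : predT x0)) => w _ h.
by exists w; rewrite inE; apply/forallP=> v; apply: h.
Qed.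

Lemma closest_centers (x0 : V) :
  exists c w, [/\ c \in center e, w \in core_center e
    & forall c' w', c' \in center e -> w' \in core_center e ->
        dist e c w <= dist e c' w'].
Proof.
have [c0 hc0] := center_nonempty x0; have [w0 hw0] := core_center_nonempty x0.
have h0 : [pred p : V * V | (p.1 \in center e) && (p.2 \in core_center e)] (c0, w0).
  by rewrite /= hc0 hw0.
case: (arg_minnP (fun p : V * V => dist e p.1 p.2) h0) => -[c w] /andP[hc hw] h.
exists c, w; split=> // c' w' hc' hw'.
by apply: (h (c', w')); rewrite /= hc' hw'.
Qed.

End Centers.

(** * The path through a closest pair of centers *)

Section UpperBound.

Variables (V : finType) (e : rel V).
Hypothesis hT : is_tree e.

Let e_sym := tree_sym hT.

(** Any neighbour of z other than its predecessor on the path from c would be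
    farther from c than z. *)
Lemma farthest_leaf (c z a b : V) :
  dist e c z = eccentricity e c -> e z a -> e z b -> a = b.
Proof.
move=> zE.
suff [x h] : exists x, forall a, e z a -> a = x by move=> /h-> /h->.
have [p ep [up lp]] := tree_path hT c z.
case: (lastP p) ep up lp => {p}[|p t] ep up lp.
  move: lp => /= lp; subst z.
  exists c => t ezt; move: (dist_leq_ecc e c t); rewrite -zE.
  rewrite (dist_path hT (p := [::])) // (dist_path hT (p := [:: t])) //=.
    by rewrite ezt.
  rewrite inE andbT; apply: contraTneq ezt => <-.
  by case: hT => _ ->.
move: lp; rewrite last_rcons => tz; rewrite {t}tz in ep up *.
exists (last c p) => t ezt; apply: contraTeq isT => ne.
have [||ej uj] := path_join hT ep up (_ : path e z [:: t]) _ ne.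
- by rewrite /= ezt.
- rewrite /= inE andbT; apply: contraTneq ezt => <-.
  by case: hT => _ ->.
have Ez := dist_path hT ep up; rewrite last_rcons in Ez.
have Et := dist_path hT ej uj; rewrite last_cat /= in Et.
by have := dist_leq_ecc e c t; rewrite -zE Ez Et size_cat addn1 ltnn.
Qed.

(** Here r is the eccentricity of c, attained at a leaf z beyond c; q is the
    distance from w to the vertex u attaining the eccentric subtree number of
    the neighbour v of w; and s + 1 is the distance from v to z. *)
Lemma closest_centers_gap (c w : V) :
  c \in center e -> w \in core_center e ->
  (forall c' w', c' \in center e -> w' \in core_center e ->
     dist e c w <= dist e c' w') ->
  0 < dist e c w ->
  exists r q s, [/\ r + dist e c w = s + 2, dist e c w + q <= r,
    q + s + 3 <= #|V| & s < q.-1 * 2 ^ (#|V| - (q + s + 3))].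
Proof.
move=> hc hw closest; rewrite dist_sym // => d0.
set r := eccentricity e c.
have [R eR [uR lR]] := tree_path hT w c.
have dR : dist e w c = size R by rewrite -lR dist_path.
(* The path from w to c starts with v and has x1 as its last vertex before c. *)
case: R eR uR lR dR => [|v R'] eR uR lR dR; first by rewrite dR in d0.
have [u uE] := ecc_subtree_attained e v.
have vcore : v \notin core_center e.
  apply/negP=> hv; have := closest _ _ hc hv.
  rewrite dist_sym // dR [X in _ < X]dist_sym // -lR dist_path ?ltnn //=.
  - by case/andP: eR.
  - by case/andP: uR.
have fvu t : subtree_number e v u < subtree_number e w t.
  rewrite -uE; apply: leq_trans (core_center_lt hw vcore) _.
  exact: ecc_subtree_leq.
have [R0 R0E] : exists R0, v :: R' = rcons R0 c.
  by rewrite lastI -lR; exists (belast v R').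
(* As x1 is not central, a vertex z farthest from it lies on the other side of c. *)
set x1 := last w R0.
move: (eR) (uR); rewrite R0E rcons_path -rcons_cons rcons_uniq.
case/andP=> eR0 ex1c /andP[_ uR0].
have x1center : x1 \notin center e.
  apply/negP=> hx1; have := closest _ _ hx1 hw.
  rewrite dist_sym // dR dist_sym // dist_path // R0E size_rcons.
  by rewrite ltnn.
have [z zE] := ecc_attained e x1.
have x1lt := center_lt hc x1center.
have czE : dist e c z = r.
  apply/eqP; rewrite eqn_leq dist_leq_ecc /= -ltnS.
  by apply: leq_trans x1lt _; rewrite zE dist_step.
have [p ep [up lp]] := tree_path hT c z.
have szp : size p = r by rewrite -czE -lp dist_path.
have hp : ohead p != Some x1.
  case: (p) ep up lp szp => // a p' ep up lp szp; apply: contraTneq x1lt => -[ax].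
  have Ez : dist e a (last a p') = size p'.
    by apply: dist_path => //; [case/andP: ep | case/andP: up].
  by rewrite -leqNgt zE -ax -lp /= Ez -/r -szp /=.
rewrite R0E in eR uR.
have [eW uW] := path_join hT eR uR ep up hp.
rewrite -R0E /= in eW uW.
have dr : dist e w c <= r by rewrite dist_sym // dist_leq_ecc.
have [y [Q WE]] : exists y Q, R' ++ p = y :: Q.
  case WE: (R' ++ p) => [|y Q]; last by exists y, Q.
  have := congr1 size WE; rewrite size_cat szp /= => /eqP.
  by rewrite addn_eq0 => /andP[_ /eqP r0]; rewrite r0 leqn0 in dr; rewrite (eqP dr) in d0.
rewrite WE in eW uW.
have lQ : last y Q = z.
  have : last v (R' ++ p) = z by rewrite last_cat -[last v R']/(last w (v :: R')) lR.
  by rewrite WE.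
have [U eU [uU lU]] := tree_path hT w u.
(* If v were on the way from w to u, then f(w,u) <= f(v,u). *)
have hU : ohead U != Some v.
  case: (U) eU uU lU => // a U' eU uU lU; apply: contraTneq (fvu u) => -[av].
  rewrite -leqNgt !subtree_numberE //; apply: leq_connected_supersets => S cS.
  rewrite !subUset !sub1set => /andP[wS uS]; rewrite uS andbT.
  apply: (connected_set_convex hT cS wS eU uU); first by rewrite lU.
  by rewrite av !inE eqxx orbT.
have leafz a b : e (last y Q) a -> e (last y Q) b -> a = b.
  by rewrite lQ; apply: farthest_leaf czE.
have lt : subtree_number e v (last w U) < subtree_number e w (last y Q).
  by rewrite lU.
have [leV gap] := subtree_number_gap hT eW uW eU uU hU leafz lt.
exists r, (size U), (size Q); split=> //.
  have := congr1 size WE; rewrite size_cat szp /= dR /= addn2 addnS addnC.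
  by move=> ->.
rewrite addnC; apply: leq_trans (dist_leq_ecc e c u); rewrite leq_eqVlt.
apply/orP; left; apply/eqP; rewrite [RHS]dist_sym //.
case: U eU uU lU hU {leV gap lt} => [|a U] eU uU lU hU.
  by rewrite -lU.
have [eU' uU' _ _] := rev_path_uniq e_sym eU uU.
have ea : path e a U by case/andP: eU.
have ua : uniq (a :: U) by case/andP: uU.
have [_ _ la _] := rev_path_uniq e_sym ea ua.
rewrite lU /= rev_cons in eU' uU'.
rewrite -[last a U]/(last w (a :: U)) lU in la.
rewrite -R0E in eR uR.
have [|eX uX] := path_join hT eU' uU' eR uR.
  by rewrite la eq_sym.
have := dist_path hT eX uX; rewrite last_cat last_rcons lR => ->.
by rewrite size_cat size_rcons size_rev size_belast dR.
Qed.

End UpperBound.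

(** * The path-star tree *)

Section PathStar.

Variables (V : finType) (e : rel V) (k : nat) (pos : V -> nat).
Hypothesis hT : is_tree e.

(** The path-star tree seen through the position of its vertices: the path
    vertices have positions 0 .. k - 1 and all pendant vertices position k. *)
Hypothesis pos_leq : forall x, pos x <= k.
Hypothesis adj_pos : forall x y,
  e x y = ((pos x).+1 == pos y) || ((pos y).+1 == pos x).
Hypothesis pos_inj : forall x y, pos x < k -> pos x = pos y -> x = y.
Hypothesis pos_surj : forall j, j <= k -> exists x, pos x = j.

Let e_sym := tree_sym hT.

Lemma pos_step (x y : V) : e x y -> pos x <= (pos y).+1 /\ pos y <= (pos x).+1.
Proof. by rewrite adj_pos => /orP[] /eqP <-; split; lia. Qed.

Lemma pos_leq_dist (x y : V) : pos y <= pos x + dist e x y.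
Proof.
have [p ep [up <-]] := tree_path hT x y; rewrite dist_path // => {y up}.
elim: p x ep => [|a p IH] x /=; first by rewrite addn0.
case/andP=> /pos_step[_ le] /IH; move/leq_trans; apply.
by rewrite addnS -addSn leq_add2r.
Qed.

Lemma dist_leq_pos (x y : V) :
  pos x < k -> pos x <= pos y -> dist e x y <= pos y - pos x.
Proof.
move=> xk xy; move: {2}(pos y - pos x) (erefl (pos y - pos x)) => m.
elim: m x xk xy => [|m IH] x xk xy E.
  have <- : x = y by apply: pos_inj => //; lia.
  by rewrite (dist_path hT (p := [::])).
have [yE|ny] := eqVneq (pos y) (pos x).+1.
  have exy : path e x [:: y] by rewrite /= adj_pos yE eqxx.
  by have := dist_walk hT exy; rewrite /= E; lia.
have [x' x'E] := pos_surj xk.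
have exx' : e x x' by rewrite adj_pos x'E eqxx.
apply: leq_trans (dist_step hT y exx') _.
have yk := pos_leq y.
rewrite E ltnS; apply: leq_trans (IH x' _ _ _) _; rewrite x'E; lia.
Qed.

(** The vertex at position k / 2 has eccentricity at most k - k / 2, while a
    pendant vertex is at distance at least k - pos c from c. *)
Lemma center_pos (c : V) : c \in center e -> k./2 <= pos c.
Proof.
have [k0|k0] := posnP k; first by rewrite k0.
have [m mE] : exists m, pos m = k./2 by apply: pos_surj; lia.
have [t tE] := pos_surj (leqnn k).
rewrite inE => /forallP /(_ m) le.
have : eccentricity e m <= k - k./2.
  apply/bigmax_leqP=> u _; have uk := pos_leq u.
  have [mu|um] := leqP (pos m) (pos u).
    by apply: leq_trans (dist_leq_pos _ mu) _; lia.
  by rewrite dist_sym //; apply: leq_trans (dist_leq_pos _ (ltnW um)) _; lia.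
move/(leq_trans le)/(leq_trans (dist_leq_ecc e c t)).
by have := pos_leq_dist c t; rewrite tE; lia.
Qed.

Hypothesis k_gt3 : 3 < k.

Definition layers (j : nat) : {set V} := [set x | pos x <= j].

(** Positions change by at most one along an edge, so a connected set takes
    every intermediate position, and a position below k determines the
    vertex. *)
Lemma pos_ivt (S : {set V}) (a b v : V) :
  connected_set e S -> a \in S -> b \in S -> pos a <= pos v <= pos b ->
  pos v < k -> v \in S.
Proof.
move=> /connected_setP cS aS bS /andP[av vb] vk.
have [p ep [_ lp]] := connect_uniq_path (cS _ _ aS bS).
have [ep' pS] := inner_path_sub ep.
rewrite -lp in vb; elim: p a aS av ep' pS vb {ep lp} => [|a' p IH] a aS av /=.
  by move=> _ _ va; rewrite (pos_inj vk (_ : pos v = pos a)) //; apply/eqP;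
    rewrite eqn_leq va.
case/andP=> /pos_step[_ le] ep pS vb.
have [va|va] := eqVneq (pos v) (pos a); first by rewrite (pos_inj vk va).
apply: (IH a') => //; first by apply: pS; rewrite mem_head.
  by move: va av le; lia.
by move=> t tp; apply: pS; rewrite inE tp orbT.
Qed.

Lemma descending_connected (S : {set V}) :
  {in S, forall x, forall y, (pos y).+1 = pos x -> y \in S} -> connected_set e S.
Proof.
move=> down; have [z zE] := pos_surj (leq0n k).
apply: (@connected_set_root _ _ e_sym _ z) => x xS.
elim: (pos x) {-2}x (erefl (pos x)) xS => [|m IH] {}x xE xS.
  by rewrite (pos_inj _ (_ : pos z = pos x)) ?zE ?xE //; apply: leq_trans k_gt3.
have [y yE] : exists y, pos y = m by apply: pos_surj; have := pos_leq x; lia.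
have yS : y \in S by apply: (down x); rewrite ?yE.
apply: connect_trans (IH y yE yS) _; apply: connect1.
by rewrite /inner_rel /= yS xS adj_pos yE xE eqxx.
Qed.

Lemma layers_connected (j : nat) : connected_set e (layers j).
Proof. by apply: descending_connected => x; rewrite inE => xj y yx; rewrite inE; lia. Qed.

Lemma layers_sub_connected (S : {set V}) :
  layers k.-1 \subset S -> connected_set e S.
Proof.
move=> /subsetP LS; apply: descending_connected => x _ y yx.
by apply: LS; rewrite inE; have := pos_leq x; lia.
Qed.

Lemma card_layers (j : nat) : j < k -> #|layers j| = j.+1.
Proof.
elim: j => [|j IH] jk.
  have [z zE] := pos_surj (leq0n k).
  rewrite (_ : layers 0 = [set z]) ?cards1 //; apply/setP=> x; rewrite !inE leqn0.
  apply/eqP/eqP=> [x0|->] //; symmetry; apply: pos_inj; by rewrite zE.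
have [y yE] := pos_surj (ltnW jk).
rewrite (_ : layers j.+1 = y |: layers j).
  by rewrite cardsU1 IH ?(ltnW jk) // inE yE ltnn.
apply/setP=> x; rewrite !inE [pos x <= j.+1]leq_eqVlt ltnS; congr (_ || _).
apply/eqP/eqP=> [xE|->] //; symmetry; apply: pos_inj; by rewrite yE.
Qed.

Variable g : nat.
Hypothesis card_V : #|V| = k + g.

(** The sets containing u and the whole path are all connected. *)
Lemma card_supersets_root_geq (z u : V) :
  pos z = 0 -> 2 ^ (g - 1) <= #|connected_supersets e [set z; u]|.
Proof.
move=> z0; apply: (@leq_trans (2 ^ (#|V| - #|u |: layers k.-1|))).
  rewrite leq_pexp2l // cardsU1 card_layers ?card_V; lia.
rewrite -card_supersets; apply: subset_leq_card; apply/subsetP=> S.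
rewrite !inE !subUset !sub1set => /andP[uS LS]; rewrite layers_sub_connected //.
by rewrite uS (subsetP LS) // inE z0.
Qed.

(** A connected set through the free end z and x either stops on the path, and
    is then an initial segment, or contains the whole path and some pendant
    vertices. *)
Lemma card_supersets_root_leq (z x : V) :
  pos z = 0 -> pos x < k ->
  #|connected_supersets e [set z; x]| <= k.-1 - pos x + 2 ^ g.
Proof.
move=> z0 xk; move: {2}(k.-1 - pos x) (erefl (k.-1 - pos x)) => m.
elim: m x xk => [|m IH] x xk E; rewrite E.
  rewrite add0n; have -> : g = #|V| - #|layers k.-1|.
    by rewrite card_layers ?card_V; lia.
  rewrite -card_supersets; apply: subset_leq_card; apply/subsetP=> S.
  rewrite !inE subUset !sub1set => /and3P[cS zS xS].
  apply/subsetP=> t; rewrite inE => tk.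
  by apply: (pos_ivt cS zS xS); rewrite ?z0; lia.
have [y yE] := pos_surj xk.
rewrite (connected_supersets_split e _ y) addSn -add1n; apply: leq_add.
  rewrite -(cards1 (layers (pos x))); apply: subset_leq_card.
  apply/subsetP=> S; rewrite !inE subUset !sub1set => /andP[/and3P[cS zS xS] yS].
  apply/eqP/setP=> t; rewrite inE; apply/idP/idP=> [tS|tx].
    rewrite leqNgt; apply: contra yS => xt.
    by apply: (pos_ivt cS xS tS); rewrite yE; lia.
  by apply: (pos_ivt cS zS xS); rewrite ?z0; lia.
have Ey : k.-1 - pos y = m by rewrite yE; lia.
rewrite -[m in X in _ <= X]Ey; apply: leq_trans (IH y _ Ey); last by lia.
apply: leq_connected_supersets => S _.
by rewrite !subUset !sub1set => /and3P[-> ->].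
Qed.

(** From a subtree through z and u one can remove nothing, the free end z, or z
    and its neighbour y, and keep a subtree through v and u. *)
Lemma card_supersets_triple (z v u : V) :
  pos z = 0 -> 2 <= pos v < k -> pos v <= pos u ->
  3 * #|connected_supersets e [set z; u]| <= #|connected_supersets e [set v; u]|.
Proof.
move=> z0 /andP[v2 vk] vu.
have [y y1] : exists y, pos y = 1 by apply: pos_surj; lia.
have k2 : 2 < k := ltnW k_gt3.
have u2 := leq_trans v2 vu; have v1 := ltnW v2; have v0 := ltnW v1.
have [u1 u0] := (leq_trans v1 vu, leq_trans v0 vu).
have zv : z != v by apply: contraTneq v2 => <-; rewrite z0.
have zu : z != u by apply: contraTneq v2 => zu; move: vu; rewrite -zu z0; lia.
have yv : y != v by apply: contraTneq v2 => <-; rewrite y1.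
have yu : y != u by apply: contraTneq v2 => yu; move: vu; rewrite -yu y1; lia.
have zy : z != y by apply/negP=> /eqP zy; move: z0; rewrite zy y1.
have mem S : S \in connected_supersets e [set z; u] ->
    [/\ z \in S, y \in S, v \in S & u \in S] /\
    connected_set e (S :\ z) /\ connected_set e (S :\ z :\ y).
  rewrite !inE subUset !sub1set => /and3P[cS zS uS].
  have yS : y \in S by apply: (pos_ivt cS zS uS); rewrite ?z0 y1 // (ltnW k2).
  have vS : v \in S by apply: (pos_ivt cS zS uS); rewrite ?z0 ?vu.
  have cSz : connected_set e (S :\ z).
    apply: connected_setD1 => // a b _ _; rewrite !adj_pos z0 /= !orbF.
    by move=> /eqP az /eqP bz; apply: pos_inj; rewrite -az // (ltnW k2).
  split=> //; split=> //; apply: connected_setD1 => // a b.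
  have only2 t : t \in S :\ z -> e y t -> pos t = 2.
    rewrite !inE adj_pos y1 => /andP[tz _] /orP[/eqP//|/eqP[t0]].
    by case/eqP: tz; apply: pos_inj; rewrite t0 // (ltnW (ltnW k2)).
  move=> aS bS /(only2 a aS) a2 /(only2 b bS) b2.
  by apply: pos_inj; rewrite a2.
rewrite (connected_supersets_split e [set v; u] y) mulSn; apply: leq_add.
  apply: (@leq_card_inj _ _ _ _ (fun S => S :\ z :\ y)) => [S S'|S].
    move=> /mem[[zS yS _ _] _] /mem[[zS' yS' _ _] _] E.
    rewrite -(setD1K zS) -(setD1K zS').
    rewrite -(setD1K (_ : y \in S :\ z)) ?E ?(setD1K (_ : y \in S' :\ z)) //.
      by rewrite !inE eq_sym zy.
    by rewrite !inE eq_sym zy.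
  move=> /mem[[zS yS vS uS] [_ cS]]; rewrite !inE cS eqxx /= andbT.
  by rewrite subUset !sub1set !inE ![v == _]eq_sym ![u == _]eq_sym yv yu zv zu vS uS.
rewrite (connected_supersets_split e (y |: _) z) mulSn mul1n; apply: leq_add.
  apply: (@leq_card_inj _ _ _ _ (fun S => S :\ z)) => [S S'|S].
    move=> /mem[[zS _ _ _] _] /mem[[zS' _ _ _] _] E.
    by rewrite -(setD1K zS) -(setD1K zS') E.
  move=> /mem[[zS yS vS uS] [cS _]]; rewrite !inE cS eqxx /= andbT.
  rewrite !subUset !sub1set !inE [y == _]eq_sym [v == _]eq_sym [u == _]eq_sym.
  by rewrite zy zv zu yS vS uS.
apply: subset_leq_card; apply/subsetP=> S hS; have [[zS yS vS uS] _] := mem S hS.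
by move: hS; rewrite !inE !subUset !sub1set zS yS vS uS => /andP[->].
Qed.

(** The predecessor v of w has a larger eccentric subtree number than w: f(v,u)
    is compared with f(w,u) when u is behind v, and with f(w,z), for the free
    end z, otherwise. *)
Lemma core_center_pos (w : V) :
  k - 4 < 2 ^ (g - 1) -> 0 < g -> w \in core_center e -> pos w <= 2.
Proof.
move=> kg g0 hw; rewrite leqNgt; apply/negP=> w3.
have wk := pos_leq w.
have [z z0] := pos_surj (leq0n k).
have [v vE] : exists v, pos v = (pos w).-1 by apply: pos_surj; lia.
suff h u : ecc_subtree_number e w < subtree_number e v u.
  have [u uE] := ecc_subtree_attained e v.
  by move: hw; rewrite inE => /forallP /(_ v); rewrite uE leqNgt h.
have [uw|wu] := ltnP (pos u) (pos w).
  apply: leq_ltn_trans (ecc_subtree_leq e w u) _.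
  rewrite !subtree_numberE // (connected_supersets_split e [set v; u] w).
  rewrite -add1n; apply: leq_add.
    rewrite card_gt0; apply/set0Pn; exists (layers (pos v)).
    by rewrite !inE layers_connected subUset !sub1set !inE; lia.
  apply: leq_connected_supersets => S cS.
  rewrite !subUset !sub1set => /andP[wS uS]; rewrite wS uS andbT /=.
  by apply: (pos_ivt cS uS wS); lia.
apply: leq_ltn_trans (ecc_subtree_leq e w z) _.
rewrite !subtree_numberE //.
have [x x3] := pos_surj (ltnW k_gt3).
have step1 : #|connected_supersets e [set w; z]| <= k - 4 + 2 ^ g.
  apply: (@leq_trans #|connected_supersets e [set z; x]|).
    apply: leq_connected_supersets => S cS.
    rewrite !subUset !sub1set => /andP[wS zS]; rewrite zS.
    by apply: (pos_ivt cS zS wS); lia.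
  apply: leq_trans (card_supersets_root_leq z0 _) _; first by rewrite x3.
  by rewrite x3; lia.
have step2 : 3 * 2 ^ (g - 1) <= #|connected_supersets e [set v; u]|.
  apply: leq_trans (card_supersets_triple z0 _ _); last 2 first.
  - by rewrite vE; lia.
  - by rewrite vE; lia.
  by rewrite leq_mul2l (card_supersets_root_geq _ z0).
apply: leq_ltn_trans step1 _; apply: leq_trans step2.
have -> : 2 ^ g = 2 * 2 ^ (g - 1) by rewrite -expnS subn1 prednK.
by rewrite mulSn ltn_add2r.
Qed.

End PathStar.

(** * The bound *)

(** If d exceeded the bound, then s >= 2^(g-2) + t for q = t + 2, whereas
    the number x of remaining vertices is at most g - 2 - 2t, so that
    (t + 1) 2^x <= 2^(t + x) <= 2^(g-2). *)
Lemma gap_bound (n g d r q s : nat) :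
  2 <= g -> 2 ^ (g - 2) + g + 3 <= n ->
  r + d = s + 2 -> d + q <= r -> q + s + 3 <= n ->
  s < q.-1 * 2 ^ (n - (q + s + 3)) -> d <= (n - g - 4)./2.
Proof.
move=> g2 gn rds dqr len lt; rewrite leqNgt; apply/negP=> dlt.
have q2 : 1 < q by move: lt; case: q {dqr len} => [|[|]].
have [t qE] : exists t, q = t.+2 by exists (q - 2); lia.
move: lt; rewrite leqNgt => /negP; apply; rewrite ltnS {q2}qE /= in dqr len *.
set x := n - _.
have big : 2 ^ (g - 2) <= s - t by lia.
have xt : t + t + x <= g - 2 by rewrite /x; lia.
have : t.+1 * 2 ^ x <= 2 ^ (g - 2).
  apply: leq_trans (_ : 2 ^ (t + x) <= _); last by rewrite leq_pexp2l //; lia.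
  by rewrite expnD leq_mul2r ltn_expl ?orbT.
by move/leq_trans; apply; apply: leq_trans big _; rewrite leq_subr.
Qed.

(** This is the failure of the defining inequality at g - 1. *)
Lemma minimal_threshold (n g : nat) :
  2 <= g ->
  (forall h, 0 < h -> n - 3 <= 2 ^ (h - 1) + h -> g <= h) ->
  2 ^ (g - 2) + g + 3 <= n.
Proof.
move=> g2 hmin; rewrite leqNgt; apply/negP=> lt.
have := hmin (g - 1); rewrite -subnDA addn1 => h.
have : g <= g - 1 by apply: h; lia.
by lia.
Qed.

Lemma center_core_dist_leq (V : finType) (e : rel V) (g : nat) :
  is_tree e -> 2 <= g -> 2 ^ (g - 2) + g + 3 <= #|V| ->
  center_core_dist e <= (#|V| - g - 4)./2.
Proof.
move=> hT g2 gn; have V0 : 0 < #|V| by apply: leq_trans gn; rewrite addn3.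
case/card_gt0P: (V0) => x0 _.
have [c [w [hc hw closest]]] := closest_centers e x0.
apply: leq_trans (set_dist_leq e hc hw) _.
have [->//|d0] := posnP (dist e c w).
have [r [q [s [h1 h2 h3 h4]]]] := closest_centers_gap hT hc hw closest d0.
exact: gap_bound h1 h2 h3 h4.
Qed.

Lemma path_star_center_core_dist (V : finType) (e : rel V) (k g : nat) :
  is_tree e -> 3 < k -> 0 < g -> k - 4 < 2 ^ (g - 1) ->
  graph_iso e (path_star k g) -> (k - 4)./2 <= center_core_dist e.
Proof.
move=> hT k3 g0 kg [f [f' fK f'K] fe].
pose pos x := minn (f x) k.
have card_V : #|V| = k + g.
  by rewrite -(card_ord (k + g)); apply: bij_eq_card; exists f'.
have pos_leq x : pos x <= k by apply: geq_minr.
have adj_pos x y : e x y = ((pos x).+1 == pos y) || ((pos y).+1 == pos x).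
  rewrite -fe /pos /path_star /= /path_star_arc.
  by move: (nat_of_ord (f x)) (nat_of_ord (f y)) => a b; clear -k3; lia.
have pos_inj x y : pos x < k -> pos x = pos y -> x = y.
  rewrite /pos => xk E; apply: (can_inj fK); apply: val_inj => /=.
  by move: xk E; move: (nat_of_ord (f x)) (nat_of_ord (f y)) => i j; clear; lia.
have pos_surj j : j <= k -> exists x, pos x = j.
  move=> jk; have lt : j < k + g by move: jk g0; clear; lia.
  by exists (f' (Ordinal lt)); rewrite /pos f'K /=; apply/minn_idPl.
apply: leq_set_dist => [|c w hc hw].
  by rewrite card_V; clear; lia.
have hcp := center_pos hT pos_leq adj_pos pos_inj pos_surj hc.
have hwp := core_center_pos hT pos_leq adj_pos pos_inj pos_surj k3 card_V kg g0 hw.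
have := pos_leq_dist hT adj_pos w c; rewrite dist_sym //.
by move: hcp hwp; clear; lia.
Qed.

Unset Implicit Arguments.

Theorem theorem5p3 (n g0 : nat) (V : finType) (e : rel V)
  (hT : is_tree e) (hn : #|V| = n) (hn6 : 6 <= n)
  (hg0 : 2 <= g0) (hg0n : n - 3 <= 2 ^ (g0 - 1) + g0)
  (hmin : forall g : nat, 0 < g -> n - 3 <= 2 ^ (g - 1) + g -> g0 <= g) :
  center_core_dist e <= (n - g0 - 4)./2 /\
  (graph_iso e (path_star (n - g0) g0) ->
   center_core_dist e = (n - g0 - 4)./2).
Proof.
have gn := minimal_threshold hg0 hmin.
have upper : center_core_dist e <= (n - g0 - 4)./2.
  by rewrite -hn; apply: center_core_dist_leq; rewrite ?hn.
split=> // iso; apply/eqP; rewrite eqn_leq upper.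
have X : 0 < 2 ^ (g0 - 2) by rewrite expn_gt0.
by apply: path_star_center_core_dist iso => //; lia.
Qed.
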